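(* Let $\mathfrak{M}=(\mathbf{M},\models,\mathcal{P}(\mathscr{L}))$ be a normal abstract model structure, $\tau_N$ the topology on $\mathbf{M}$ generated by $\{\mathbf{M}\setminus\mathsf{Mod}(\{\alpha\})\mid\alpha\in\mathscr{L}\}$ as a subbase, $(m_i)_{i\in I}$ a family in $\mathbf{M}$, $\mathcal{U}$ an ultrafilter on $I$, and $\mathsf{u}\in\mathbf{M}$. Then $\mathsf{u}$ is a $\mathcal{U}$-ultralimit of $(m_i)_{i\in I}$ in $(\mathbf{M},\tau_N)$ iff for all $\Sigma\subseteq\mathscr{L}$, $\{i\in I\mid m_i\models\Sigma\}\in\mathcal{U}$ implies $\mathsf{u}\models\Sigma$.
   Context: An abstract model structure is a triple $(\mathbf{M},\models,\mathcal{P}(\mathscr{L}))$ with $\mathbf{M}\neq\emptyset$, $\mathscr{L}$ a set and $\models\,\subseteq\mathbf{M}\times\mathcal{P}(\mathscr{L})$. It is normal if for all $m$ and $\Gamma$: $m\models\Gamma$ iff $m\models\{\alpha\}$ for all $\alpha\in\Gamma$. $\mathsf{Mod}(\Gamma)=\{m\in\mathbf{M}\mid m\models\Gamma\}$. For a topological space $(X,\tau)$, a family $(x_i)_{i\in I}$ in $X$ and an ultrafilter $\mathcal{U}$ on $I$, a point $x\in X$ is a $\mathcal{U}$-ultralimit of $(x_i)_{i\in I}$ if for every $\tau$-open $U\ni x$, $\{i\in I\mid x_i\in U\}\in\mathcal{U}$. *)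

(* Defs.v *)
From HB Require Import structures.
From mathcomp Require Import all_boot all_order.
From mathcomp Require Import all_classical.
From mathcomp Require Import topology.

Set Implicit Arguments.
Unset Strict Implicit.
Unset Printing Implicit Defensive.

Local Open Scope classical_set_scope.

Record abstract_model_structure := AbstractModelStructure {
  model : Type;
  language : Type;
  satisfies : model -> set language -> Prop;
  model_nonempty : inhabited model
}.

Definition normal (A : abstract_model_structure) : Prop :=
  forall (m : model A) (Gamma : set (language A)),
    satisfies m Gamma <-> forall alpha, Gamma alpha -> satisfies m [set alpha].

Definition Mod (A : abstract_model_structure) (Gamma : set (language A)) :
  set (model A) := [set m | satisfies m Gamma].

Definition tauN_subbase (A : abstract_model_structure) :
  set_system (model A) := [set ~` Mod [set alpha] | alpha in [set: language A]].

(* An alias of the carrier, used to attach the topology to it. Topological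
   types must be choice types, hence the classical choice structure. *)
Definition tauN (A : abstract_model_structure) : Type := model A.

HB.instance Definition _ (A : abstract_model_structure) :=
  gen_eqMixin (tauN A).
HB.instance Definition _ (A : abstract_model_structure) :=
  gen_choiceMixin (tauN A).
HB.instance Definition _ (A : abstract_model_structure) :=
  isSubBaseTopological.Build (tauN A) (@tauN_subbase A) id.

Definition is_ultralimit (X : topologicalType) (I : Type) (U : set_system I)
    (x : I -> X) (p : X) : Prop :=
  forall V : set X, open V -> V p -> U [set i | V (x i)].

(* Main.v *)
Require Import Defs.
From mathcomp Require Import all_boot all_order.
From mathcomp Require Import all_classical.
From mathcomp Require Import topology.

Local Open Scope classical_set_scope.

(** Convergence along [U] can be tested on subbasic sets, so [u] is an ultralimit iff each sentence
    failing at [u] fails at [U]-almost all [m i] ([is_ultralimit_tauNP]). Since [U] contains a set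
    or its complement, but never both, this is the contrapositive of the claim for singletons;
    normality passes from singletons to arbitrary [Sigma]. *)

Lemma open_tauNE (A : abstract_model_structure) (V : set (tauN A)) :
  open V =
  (exists2 D : set (set (tauN A)),
     D `<=` finI_from (@tauN_subbase A) id & \bigcup_(W in D) W = V).
Proof. by []. Qed.

Lemma open_tauN_setC_Mod1 (A : abstract_model_structure) (alpha : language A) :
  open (~` Mod [set alpha] : set (tauN A)).
Proof.
rewrite open_tauNE; exists [set ~` Mod [set alpha]]; last exact: bigcup_set1.
by move=> _ ->; apply: (@finI_from1 _ _ _ id); exists alpha.
Qed.

(* Filters are closed under finite intersections and supersets, so subbasic
   neighbourhoods suffice. *)
Lemma is_ultralimit_tauNP (A : abstract_model_structure) (I : Type)
    (m : I -> model A) (U : set_system I) (FU : Filter U) (u : model A) :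
  is_ultralimit (X := tauN A) U m u <->
  forall alpha, ~ satisfies u [set alpha] ->
    U [set i | ~ satisfies (m i) [set alpha]].
Proof.
split=> [ulim alpha|usub V].
  exact/(ulim (~` Mod [set alpha]))/open_tauN_setC_Mod1.
rewrite open_tauNE => -[D sub_D <-] [W DW Wu].
apply: (@filterS _ U _ [set i | W (m i)]) => [i Wmi|]; first by exists W.
have [E sub_E defW] := sub_D W DW; rewrite -defW in Wu *.
(* Preimage under [m] commutes with the intersection over [E], by mere conversion. *)
apply: (@filter_bigI _ _ E (fun S => m @^-1` S) U) => S ES.
have /set_mem [alpha _ defS] := sub_E S ES.
by have := Wu S ES; rewrite /= -defS; apply: usub.
Qed.

Theorem theorem3p37 (A : abstract_model_structure) (hA : normal A)
    (I : Type) (m : I -> model A) (U : set_system I) (hU : UltraFilter U)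
    (u : model A) :
  is_ultralimit (X := tauN A) U m u <->
  forall Sigma : set (language A),
    U [set i | satisfies (m i) Sigma] -> satisfies u Sigma.
Proof.
rewrite is_ultralimit_tauNP; split=> [usub Sigma USigma|usat alpha Nualpha].
  (* If [u] failed some [alpha] in [Sigma], then [U] would contain two sets that are disjoint by
     normality at [m i]: where [Sigma] holds and where [alpha] fails. *)
  apply/hA => alpha Sigma_alpha; apply: contrapT => /usub UNalpha.
  apply: (filter_not_empty U); apply: filterS (filterI USigma UNalpha).
  by move=> i [/hA/(_ alpha Sigma_alpha)].
(* Either [alpha] holds [U]-almost everywhere, and [usat] at the singleton contradicts [Nualpha], or
   the complement lies in [U], which is the goal. *)
by have [/usat|] := in_ultra_setVsetC [set i | satisfies (m i) [set alpha]] hU.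
Qed.
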